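(* Let $(A,\nwarrow,\nearrow,\swarrow,\searrow,\alpha,\beta,\tilde\alpha,\tilde\beta)$ be a quadri-bialgebra induced from a skew-symmetric solution $r\in A\otimes A$ of the $Q$-equations. If, in addition, $r$ is nondegenerate, then for all $\lambda_1,\lambda_2,\lambda_3,\lambda_4\in\mathbb F$ the linear operator $$N_{\lambda_1,\lambda_2,\lambda_3,\lambda_4}((x,a^* )):=(\lambda_1T_r(a^* )+\lambda_2x,\ \lambda_3T_r^{-1}(x)+\lambda_4a^* ),\qquad x\in A,\ a^*\in A^*,$$ is a Nijenhuis operator on the Drinfeld $Q$-double $\mathcal{QD}(A)$ (with respect to its four quadri-algebra operations).
   Context: All vector spaces are finite-dimensional over a fixed field $\mathbb F$. A quadri-algebra $(A,\nwarrow,\nearrow,\swarrow,\searrow)$ is a vector space with four bilinear operations; put $x\succ y=x\nearrow y+x\searrow y$, $x\prec y=x\nwarrow y+x\swarrow y$, $x\vee y=x\swarrow y+x\searrow y$, $x\wedge y=x\nwarrow y+x\nearrow y$, $x\star y=x\nwarrow y+x\nearrow y+x\swarrow y+x\searrow y$ (likewise with subscript $*$); the axioms are, for all $x,y,z$: $(x\nwarrow y)\nwarrow z=x\nwarrow(y\star z)$, $(x\nearrow y)\nwarrow z=x\nearrow(y\prec z)$, $(x\wedge y)\nearrow z=x\nearrow(y\succ z)$, $(x\swarrow y)\nwarrow z=x\swarrow(y\wedge z)$, $(x\searrow y)\nwarrow z=x\searrow(y\nwarrow z)$, $(x\vee y)\nearrow z=x\searrow(y\nearrow z)$, $(x\prec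 y)\swarrow z=x\swarrow(y\vee z)$, $(x\succ y)\swarrow z=x\searrow(y\swarrow z)$, $(x\star y)\searrow z=x\searrow(y\searrow z)$. $L_\circ(x)y=x\circ y=R_\circ(y)x$. For $\rho:A\to\mathfrak{gl}(V)$ linear, $\rho^*:A\to\mathfrak{gl}(V^* )$ is $\langle\rho^*(x)v^*,u\rangle=\langle v^*,\rho(x)u\rangle$ (no sign); $A^{**}=A$. For $r=\sum_ia_i\otimes b_i\in A\otimes A$: $T_r:A^*\to A$ is defined by $\langle u^*,T_r(v^* )\rangle=\langle u^*\otimes v^*,r\rangle$; $r$ is nondegenerate if $T_r$ is invertible; $r$ is skew-symmetric if it is minus its flip. With $r_{12}\diamond r_{13}=\sum_{i,j}a_i\diamond a_j\otimes b_i\otimes b_j$, $r_{13}\diamond r_{23}=\sum_{i,j}a_i\otimes a_j\otimes b_i\diamond b_j$, $r_{23}\diamond r_{12}=\sum_{i,j}a_j\otimes a_i\diamond b_j\otimes b_i$, the $Q$-equations are $r_{23}\wedge r_{12}-r_{13}\succ r_{23}+r_{12}\swarrow r_{13}=0$ and $r_{23}\vee r_{12}-r_{12}\prec r_{13}+r_{13}\nearrow r_{23}=0$. A skew-symmetric solution $r$ induces a quadri-bialgebra structure (in particular the dual maps of the comultiplications form a quadri-algebra on $A^*$) with $\alpha(x)=(-1\otimes L_\searrow(x)+R_\star(x)\otimes1)r$, $\beta(x)=(1\otimes L_\vee(x)-R_\prec(x)\otimes1)r$, $\tilde\alpha(x)=(1\otimes L_\succ(x)-R_\wedge(x)\otimes1)r$,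 $\tilde\beta(x)=(-1\otimes L_\star(x)+R_\nwarrow(x)\otimes1)r$. The quadri-algebra structure on $A^*$ is $\nwarrow_*=\alpha^*$, $\nearrow_*=\beta^*$, $\swarrow_*=\tilde\alpha^*$, $\searrow_*=\tilde\beta^*$, where $\langle a^*\nwarrow_*b^*,x\rangle=\langle a^*\otimes b^*,\alpha(x)\rangle$, etc. The quadri-algebra structure of the Drinfeld $Q$-double $\mathcal{QD}(A)=A\oplus A^*$ extends those of $A$ and $A^*$ and is given on mixed products by $x\nwarrow_\bullet a^*=R_\searrow^*(x)a^*+L_{\star_*}^*(a^* )x$, $a^*\nwarrow_\bullet x=R_{\searrow_*}^*(a^* )x+L_\star^*(x)a^*$, $x\nearrow_\bullet a^*=-R_\vee^*(x)a^*-L_{\prec_*}^*(a^* )x$, $a^*\nearrow_\bullet x=-R_{\vee_*}^*(a^* )x-L_\prec^*(x)a^*$, $x\swarrow_\bullet a^*=-R_\succ^*(x)a^*-L_{\wedge_*}^*(a^* )x$, $a^*\swarrow_\bullet x=-R_{\succ_*}^*(a^* )x-L_\wedge^*(x)a^*$, $x\searrow_\bullet a^*=R_\star^*(x)a^*+L_{\nwarrow_*}^*(a^* )x$, $a^*\searrow_\bullet x=R_{\star_*}^*(a^* )x+L_\nwarrow^*(x)a^*$. A linear operator $N$ on a vector space with a set $\Omega$ of bilinear operations is a Nijenhuis operator if for each $\ast\in\Omega$ and all $u,v$: $N(u)\ast N(v)=N(N(u)\ast v+u\ast N(v)-N(u\ast v))$. *)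

(* Defs.v *)
From HB Require Import structures.
From mathcomp Require Import all_boot all_order all_algebra.

Set Implicit Arguments.
Unset Strict Implicit.
Unset Printing Implicit Defensive.

Import GRing.Theory.
Local Open Scope ring_scope.
Local Open Scope lfun_scope.

(* vectType F is the type of finite-dimensional F-vector spaces; a bilinear   *)
(* map U x V -> W is an element of 'Hom(U, 'Hom(V, W)).                       *)
Notation dual A := 'Hom(A, GRing.regular _).
Notation bilop V := 'Hom(V, 'Hom(V, V)).

Section LinearFunctions.
Variable F : fieldType.
Implicit Types U V W : vectType F.

Lemma linfunE U V (f : U -> V) : linear f -> forall u, linfun f u = f u.
Proof.
move=> lf u; pose g : {linear U -> V} := HB.pack f (GRing.isLinear.Build F U V _ f lf).
by rewrite -[f]/(g : U -> V) lfunE.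
Qed.

Lemma linear_fun_sum U V (f : U -> V) n (x : 'I_n -> U) :
  linear f -> f (\sum_i x i) = \sum_i f (x i).
Proof.
move=> lf; rewrite -(linfunE lf) linear_sum.
by apply: eq_bigr => i _; rewrite -[RHS](linfunE lf).
Qed.

Definition bilinear_fun U V W (f : U -> V -> W) : Prop :=
  (forall u, linear (f u)) /\ (forall v, linear (f^~ v)).

(* linfun f is meaningful only for linear f, so bilin f only for bilinear f.  *)
Definition bilin U V W (f : U -> V -> W) : 'Hom(U, 'Hom(V, W)) :=
  linfun (fun u => linfun (f u)).

Lemma bilinE U V W (f : U -> V -> W) :
  bilinear_fun f -> forall u v, bilin f u v = f u v.
Proof.
move=> [fr fl] u v; rewrite /bilin linfunE ?linfunE //.
move=> k x y; apply/lfunP=> z.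
by rewrite add_lfunE scale_lfunE !linfunE // fl.
Qed.

Lemma bilinear_lfun U V W (f : 'Hom(U, 'Hom(V, W))) : bilinear_fun (fun u v => f u v).
Proof.
split=> [u | v] k x y /=; first by rewrite linearP.
by rewrite linearP add_lfunE scale_lfunE.
Qed.

Definition eval_dual V : 'Hom(V, dual (dual V)) :=
  bilin (fun (x : V) (v : dual V) => v x).

Lemma eval_dualE V (x : V) (v : dual V) : eval_dual V x v = v x.
Proof.
by rewrite bilinE //; split=> [u | w] k y z /=; rewrite ?linearP // add_lfunE scale_lfunE.
Qed.

Definition bvec V (i : 'I_(\dim {:V})) : V := (vbasis {:V})`_i.

Definition coord_dual V (i : 'I_(\dim {:V})) : dual V :=
  linfun (fun x => coord (vbasis {:V}) i x : GRing.regular F).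

Lemma coord_dualE V i (x : V) : coord_dual i x = coord (vbasis {:V}) i x.
Proof. by rewrite linfunE // => k y z; rewrite linearP. Qed.

Lemma coord_dual_sum V (x : V) : x = \sum_i coord_dual i x *: bvec i.
Proof.
by rewrite {1}(coord_vbasis (memvf x)); apply: eq_bigr => i _; rewrite coord_dualE.
Qed.

Lemma dual_sum V (v : dual V) : v = \sum_i v (bvec i) *: coord_dual i.
Proof.
apply/lfunP=> x; rewrite {1}(coord_dual_sum x) linear_sum sum_lfunE.
by apply: eq_bigr => i _; rewrite linearZ scale_lfunE; apply: mulrC.
Qed.

Lemma dual_ext V (x y : V) : (forall v : dual V, v x = v y) -> x = y.
Proof.
move=> e; rewrite (coord_dual_sum x) (coord_dual_sum y).
by apply: eq_bigr => i _; rewrite e.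
Qed.

Lemma eval_dualK V : cancel (eval_dual V) (eval_dual V)^-1.
Proof.
apply/lker0_lfunK/lker0P=> x y exy; apply: dual_ext => v.
by rewrite -(eval_dualE x) -(eval_dualE y) exy.
Qed.

Lemma eval_dualVK V : cancel (eval_dual V)^-1 (eval_dual V).
Proof.
move=> g; suff [x ->] : exists x, g = eval_dual V x by rewrite eval_dualK.
exists (\sum_i g (coord_dual i) *: bvec i).
apply/lfunP=> v; rewrite eval_dualE linear_sum {1}(dual_sum v) linear_sum.
by apply: eq_bigr => i _; rewrite !linearZ; apply: mulrC.
Qed.

Lemma eval_dualVE V (g : dual (dual V)) (v : dual V) : v ((eval_dual V)^-1 g) = g v.
Proof. by rewrite -eval_dualE eval_dualVK. Qed.

(* The transpose of an endomorphism; for endomorphisms of the dual space the  *)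
(* transpose is read on V itself through V^** = V.                            *)
Definition transp V (f : 'End(V)) : 'End(dual V) :=
  linfun (fun v : dual V => v \o f).

Definition transp_dual V (f : 'End(dual V)) : 'End(V) :=
  (eval_dual V)^-1 \o transp f \o eval_dual V.

Lemma transpE V (f : 'End(V)) (v : dual V) x : transp f v x = v (f x).
Proof.
by rewrite linfunE ?comp_lfunE // => k a b; rewrite comp_lfunDl comp_lfunZl.
Qed.

Lemma transp_dualE V (f : 'End(dual V)) (v : dual V) x :
  v (transp_dual f x) = f v x.
Proof. by rewrite !comp_lfunE eval_dualVE transpE eval_dualE. Qed.

Lemma transp_linear V : linear (@transp V).
Proof.
by move=> k f g; apply/lfunP=> v; apply/lfunP=> x;
   rewrite !(transpE, add_lfunE, scale_lfunE) linearP.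
Qed.

Lemma transp_dual_linear V : linear (@transp_dual V).
Proof.
by move=> k f g; apply/lfunP=> x; apply: dual_ext => v;
   rewrite !(transp_dualE, add_lfunE, scale_lfunE) linearP /= !transp_dualE.
Qed.

Definition L V (op : bilop V) (x : V) : 'End(V) := op x.
Definition R V (op : bilop V) (y : V) : 'End(V) := linfun (fun x => op x y).

Lemma RE V (op : bilop V) x y : R op y x = op x y.
Proof. by rewrite linfunE //; case: (bilinear_lfun op) => _; apply. Qed.

Lemma L_linear V (op : bilop V) : linear (L op).
Proof. by move=> k x y; rewrite /L linearP. Qed.

Lemma R_linear V (op : bilop V) : linear (R op).
Proof.
by move=> k y z; apply/lfunP=> x; rewrite !(add_lfunE, scale_lfunE, RE) linearP.
Qed.

End LinearFunctions.

Section Tensors.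
Variable F : fieldType.
Implicit Types U V W : vectType F.

(* In finite dimension U (x) V is the space of bilinear forms on U^* x V^*,   *)
(* and t u v is the pairing of u (x) v with t.                                *)
Definition tens U V : vectType F := 'Hom(dual U, 'Hom(dual V, GRing.regular F)).

Definition pairing U V (t : tens U V) (u : dual U) (v : dual V) : F :=
  (t : 'Hom(dual U, 'Hom(dual V, GRing.regular F))) u v.

Definition pure U V (x : U) (y : V) : tens U V :=
  bilin (fun (u : dual U) (v : dual V) => u x * v y : GRing.regular F).

Lemma pureE U V (x : U) (y : V) u v : pairing (pure x y) u v = u x * v y.
Proof.
rewrite /pairing bilinE //; split=> [f | f] k g h; rewrite add_lfunE scale_lfunE.
  by rewrite mulrDr /= mulrCA.
by rewrite mulrDl /= -mulrA.
Qed.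

Lemma pairingP U V k (s t : tens U V) u v :
  pairing (k *: s + t) u v = k * pairing s u v + pairing t u v.
Proof. by rewrite {1}/pairing add_lfunE scale_lfunE add_lfunE scale_lfunE. Qed.

Lemma pairing_bilinear U V (t : tens U V) :
  bilinear_fun (pairing t : dual U -> dual V -> GRing.regular F).
Proof. exact: bilinear_lfun. Qed.

Lemma pairing_ext U V (s t : tens U V) :
  (forall u v, pairing s u v = pairing t u v) -> s = t.
Proof. by move=> e; apply/lfunP=> u; apply/lfunP=> v; apply: e. Qed.

Lemma pure_bilinear U V : bilinear_fun (@pure U V).
Proof.
split=> [x | y] k a b; apply: pairing_ext => u v; rewrite pairingP !pureE linearP.
  by rewrite mulrDr /= mulrCA.
by rewrite mulrDl /= -mulrA.
Qed.

(* The linear map U (x) V -> W with x (x) y |-> f x y, for bilinear f.        *)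
Definition tlift U V W (f : U -> V -> W) (t : tens U V) : W :=
  \sum_i \sum_j
     pairing t (coord_dual i) (coord_dual j) *: f (bvec i) (bvec j).

Lemma tlift_linear U V W (f : U -> V -> W) : linear (tlift f).
Proof.
move=> k s t; rewrite /tlift scaler_sumr -big_split; apply: eq_bigr => i _ /=.
rewrite scaler_sumr -big_split; apply: eq_bigr => j _ /=.
by rewrite pairingP scalerDl scalerA.
Qed.

Lemma tlift_pure U V W (f : U -> V -> W) x y :
  bilinear_fun f -> tlift f (pure x y) = f x y.
Proof.
move=> bf; rewrite -(bilinE bf) {2}(coord_dual_sum x) linear_sum sum_lfunE.
apply: eq_bigr => i _; rewrite linearZ scale_lfunE /= {2}(coord_dual_sum y).
rewrite linear_sum scaler_sumr; apply: eq_bigr => j _.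
by rewrite linearZ /= bilinE // pureE scalerA.
Qed.

Lemma tens_sum U V (t : tens U V) : t = tlift (@pure U V) t.
Proof.
apply: pairing_ext => u v.
have linp : linear (fun s : tens U V => pairing s u v : GRing.regular F).
  by move=> k a b; rewrite pairingP.
rewrite -[RHS](linfunE linp) linear_sum -(bilinE (pairing_bilinear t)).
rewrite {1}(dual_sum u) linear_sum sum_lfunE.
apply: eq_bigr => i _; rewrite linear_sum linearZ scale_lfunE {1}(dual_sum v).
rewrite linear_sum scaler_sumr; apply: eq_bigr => j _.
rewrite [X in _ *: X]linearZ [RHS]linearZ /= (bilinE (pairing_bilinear t)).
by rewrite (linfunE linp) pureE [LHS]scalerA; apply: mulrC.
Qed.

Lemma tlift_sum U V W (f : U -> V -> W) n (x : 'I_n -> U) (y : 'I_n -> V) :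
  bilinear_fun f -> tlift f (\sum_i pure (x i) (y i)) = \sum_i f (x i) (y i).
Proof.
move=> bf; rewrite (linear_fun_sum _ (tlift_linear f)).
by apply: eq_bigr => i _; rewrite tlift_pure.
Qed.

Definition tswap U V : tens U V -> tens V U := tlift (fun x y => pure y x).

Definition tmap U V (f : 'End(U)) (g : 'End(V)) : tens U V -> tens U V :=
  tlift (fun x y => pure (f x) (g y)).

Definition tens_skew_symmetric V (r : tens V V) : Prop := r = - tswap r.

(* T_r v is the vector x with <u, x> = <u (x) v, r> for all u.                *)
Definition tmor V (r : tens V V) : 'Hom(dual V, V) :=
  linfun (fun v => (eval_dual V)^-1
    (linfun (fun u : dual V => pairing r u v : GRing.regular F))).

Lemma tmorE V (r : tens V V) (u v : dual V) : u (tmor r v) = pairing r u v.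
Proof.
have [br bl] := pairing_bilinear r.
rewrite linfunE; first by rewrite eval_dualVE (linfunE (bl v)).
move=> k a b; rewrite -linearP; congr (_ _); apply/lfunP=> w.
by rewrite add_lfunE scale_lfunE !(linfunE (bl _)) br.
Qed.

Definition tens_nondegenerate V (r : tens V V) : Prop := bijective (tmor r).

Lemma tmorK V (r : tens V V) : tens_nondegenerate r ->
  cancel (tmor r) (tmor r)^-1%VF /\ cancel (tmor r)^-1%VF (tmor r).
Proof.
move=> bij; have /lker0P/lker0_lfunK rK := bij_inj bij.
by split=> // x; case: bij => g _ gK; rewrite -(gK x) rK.
Qed.

Definition tens3 V : vectType F := tens (tens V V) V.

Definition pure3 V (x y z : V) : tens3 V := pure (pure x y) z.

Section LegProducts.
Variables (V : vectType F) (op : bilop V) (r : tens V V).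

Definition r12_r13 : tens3 V :=
  tlift (fun a b => tlift (fun a' b' => pure3 (op a a') b b') r) r.

Definition r13_r23 : tens3 V :=
  tlift (fun a b => tlift (fun a' b' => pure3 a a' (op b b')) r) r.

Definition r23_r12 : tens3 V :=
  tlift (fun a b => tlift (fun a' b' => pure3 a' (op a b') b) r) r.

End LegProducts.

Lemma tlift2_sum V W (f : V -> V -> V -> V -> W) n (a b : 'I_n -> V) :
    (forall x y, bilinear_fun (f x y)) ->
    (forall x y, bilinear_fun (fun z t => f z t x y)) ->
  let r := \sum_i pure (a i) (b i) in
  tlift (fun x y => tlift (f x y) r) r = \sum_i \sum_j f (a i) (b i) (a j) (b j).
Proof.
move=> b1 b2 r; rewrite {2}/r tlift_sum.
  by apply: eq_bigr => i _; rewrite tlift_sum.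
split=> [x | x] k y z; rewrite !tlift_sum // scaler_sumr -big_split;
  apply: eq_bigr => i _ /=; have [h1 h2] := b2 (a i) (b i);
  [exact: h1 | exact: h2].
Qed.

Lemma pure3Pl V (y z : V) k a b : pure3 (k *: a + b) y z = k *: pure3 a y z + pure3 b y z.
Proof.
by have [_ l1] := @pure_bilinear V V; have [_ l2] := @pure_bilinear (tens V V) V;
   rewrite /pure3 l1 l2.
Qed.

Lemma pure3Pm V (x z : V) k a b : pure3 x (k *: a + b) z = k *: pure3 x a z + pure3 x b z.
Proof.
by have [l1 _] := @pure_bilinear V V; have [_ l2] := @pure_bilinear (tens V V) V;
   rewrite /pure3 l1 l2.
Qed.

Lemma pure3Pr V (x y : V) k a b : pure3 x y (k *: a + b) = k *: pure3 x y a + pure3 x y b.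
Proof. by have [l2 _] := @pure_bilinear (tens V V) V; rewrite /pure3 l2. Qed.

Section LegProductsTheory.
Variables (V : vectType F) (op : bilop V) (n : nat) (a b : 'I_n -> V).
Let r := \sum_i pure (a i) (b i).

Local Definition pure3P :=
  (linearP, add_lfunE, scale_lfunE, pure3Pl, pure3Pm, pure3Pr).

Lemma r12_r13_sum :
  r12_r13 op r = \sum_i \sum_j pure3 (op (a i) (a j)) (b i) (b j).
Proof. by apply: tlift2_sum => x y; split=> z k s t; rewrite !pure3P. Qed.

Lemma r13_r23_sum :
  r13_r23 op r = \sum_i \sum_j pure3 (a i) (a j) (op (b i) (b j)).
Proof. by apply: tlift2_sum => x y; split=> z k s t; rewrite !pure3P. Qed.

Lemma r23_r12_sum :
  r23_r12 op r = \sum_i \sum_j pure3 (a j) (op (a i) (b j)) (b i).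
Proof. by apply: tlift2_sum => x y; split=> z k s t; rewrite !pure3P. Qed.

End LegProductsTheory.
End Tensors.

(* The four operations are those of the north-west, north-east, south-west    *)
(* and south-east arrows.                                                     *)
Record quadri_ops (F : fieldType) (A : vectType F) := QuadriOps {
  nw : bilop A; ne : bilop A; sw : bilop A; se : bilop A
}.

Section Quadri.
Variables (F : fieldType) (A : vectType F).
Implicit Type q : quadri_ops A.

Definition qsucc q : bilop A := ne q + se q.
Definition qprec q : bilop A := nw q + sw q.
Definition qvee q : bilop A := sw q + se q.
Definition qwedge q : bilop A := nw q + ne q.
Definition qstar q : bilop A := nw q + ne q + sw q + se q.

Record quadri_algebra q : Prop := QuadriAlgebra {
  quadri_nw_nw : forall x y z, nw q (nw q x y) z = nw q x (qstar q y z);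
  quadri_ne_nw : forall x y z, nw q (ne q x y) z = ne q x (qprec q y z);
  quadri_wedge_ne : forall x y z, ne q (qwedge q x y) z = ne q x (qsucc q y z);
  quadri_sw_nw : forall x y z, nw q (sw q x y) z = sw q x (qwedge q y z);
  quadri_se_nw : forall x y z, nw q (se q x y) z = se q x (nw q y z);
  quadri_vee_ne : forall x y z, ne q (qvee q x y) z = se q x (ne q y z);
  quadri_prec_sw : forall x y z, sw q (qprec q x y) z = sw q x (qvee q y z);
  quadri_succ_sw : forall x y z, sw q (qsucc q x y) z = se q x (sw q y z);
  quadri_star_se : forall x y z, se q (qstar q x y) z = se q x (se q y z)
}.

End Quadri.

Section Bialgebra.
Variables (F : fieldType) (A : vectType F).
Implicit Type q : quadri_ops A.

Definition Q_equations q (r : tens A A) : Prop :=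
  r23_r12 (qwedge q) r - r13_r23 (qsucc q) r + r12_r13 (sw q) r = 0 /\
  r23_r12 (qvee q) r - r12_r13 (qprec q) r + r13_r23 (ne q) r = 0.

Section Comultiplications.
Variables (q : quadri_ops A) (r : tens A A).

Definition comul_nw (x : A) : tens A A :=
  - tmap \1 (L (se q) x) r + tmap (R (qstar q) x) \1 r.
Definition comul_ne (x : A) : tens A A :=
  tmap \1 (L (qvee q) x) r - tmap (R (qprec q) x) \1 r.
Definition comul_sw (x : A) : tens A A :=
  tmap \1 (L (qsucc q) x) r - tmap (R (qwedge q) x) \1 r.
Definition comul_se (x : A) : tens A A :=
  - tmap \1 (L (qstar q) x) r + tmap (R (nw q) x) \1 r.

End Comultiplications.

Definition dual_op (D : A -> tens A A) : bilop (dual A) :=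
  bilin (fun a b : dual A => linfun (fun x => pairing (D x) a b : GRing.regular F)).

Lemma dual_opE D (a b : dual A) x : linear D -> dual_op D a b x = pairing (D x) a b.
Proof.
move=> lD.
have lx (u v : dual A) : linear (fun x => pairing (D x) u v : GRing.regular F).
  by move=> k y z; rewrite lD pairingP.
rewrite /dual_op bilinE; first by rewrite (linfunE (lx _ _)).
by split=> [u | v] k y z; apply/lfunP=> w; rewrite add_lfunE scale_lfunE !(linfunE (lx _ _));
   have [h1 h2] := pairing_bilinear (D w); rewrite ?h1 ?h2.
Qed.

Lemma tmap_linear_l (f : A -> 'End(A)) (g : 'End(A)) r :
  linear f -> linear (fun x => tmap (f x) g r : tens A A).
Proof.
move=> lf k x y; rewrite /tmap /tlift scaler_sumr -big_split; apply: eq_bigr => i _ /=.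
rewrite scaler_sumr -big_split; apply: eq_bigr => j _ /=.
have [_ l] := @pure_bilinear F A A.
by rewrite lf add_lfunE scale_lfunE l scalerDr !scalerA mulrC.
Qed.

Lemma tmap_linear_r (f : 'End(A)) (g : A -> 'End(A)) r :
  linear g -> linear (fun x => tmap f (g x) r : tens A A).
Proof.
move=> lg k x y; rewrite /tmap /tlift scaler_sumr -big_split; apply: eq_bigr => i _ /=.
rewrite scaler_sumr -big_split; apply: eq_bigr => j _ /=.
have [l _] := @pure_bilinear F A A.
by rewrite lg add_lfunE scale_lfunE l scalerDr !scalerA mulrC.
Qed.

Lemma lin_sub (V : vectType F) (f g : A -> V) :
  linear f -> linear g -> linear (fun x => f x - g x).
Proof. by move=> lf lg k x y; rewrite lf lg scalerBr opprD addrACA. Qed.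

Lemma lin_Nadd (V : vectType F) (f g : A -> V) :
  linear f -> linear g -> linear (fun x => - g x + f x).
Proof. by move=> lf lg k x y; rewrite lf lg opprD -scalerN scalerDr addrACA. Qed.

Lemma comul_linear q r :
  [/\ linear (comul_nw q r), linear (comul_ne q r),
      linear (comul_sw q r) & linear (comul_se q r)].
Proof.
have ll op := tmap_linear_l \1 r (@R_linear F A op).
have lr op := tmap_linear_r \1 r (@L_linear F A op).
split=> k x y.
- exact: (lin_Nadd (ll _) (lr _)).
- exact: (lin_sub (lr _) (ll _)).
- exact: (lin_sub (lr _) (ll _)).
- exact: (lin_Nadd (ll _) (lr _)).
Qed.

Definition induced_dual q (r : tens A A) : quadri_ops (dual A) := {|
  nw := dual_op (comul_nw q r);
  ne := dual_op (comul_ne q r);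
  sw := dual_op (comul_sw q r);
  se := dual_op (comul_se q r)
|}.

Definition mixed_op (op : bilop A) (ops : bilop (dual A))
    (m : A -> dual A -> A * dual A) (ms : dual A -> A -> A * dual A) :
    bilop (A * dual A)%type :=
  bilin (fun u v : A * dual A =>
    (op u.1 v.1, ops u.2 v.2) + m u.1 v.2 + ms u.2 v.1).

Definition Q_double q (qs : quadri_ops (dual A)) : quadri_ops (A * dual A)%type := {|
  nw := mixed_op (nw q) (nw qs)
    (fun x a => (transp_dual (L (qstar qs) a) x, transp (R (se q) x) a))
    (fun a x => (transp_dual (R (se qs) a) x, transp (L (qstar q) x) a));
  ne := mixed_op (ne q) (ne qs)
    (fun x a => (- transp_dual (L (qprec qs) a) x, - transp (R (qvee q) x) a))
    (fun a x => (- transp_dual (R (qvee qs) a) x, - transp (L (qprec q) x) a));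
  sw := mixed_op (sw q) (sw qs)
    (fun x a => (- transp_dual (L (qwedge qs) a) x, - transp (R (qsucc q) x) a))
    (fun a x => (- transp_dual (R (qsucc qs) a) x, - transp (L (qwedge q) x) a));
  se := mixed_op (se q) (se qs)
    (fun x a => (transp_dual (L (nw qs) a) x, transp (R (qstar q) x) a))
    (fun a x => (transp_dual (R (qstar qs) a) x, transp (L (nw q) x) a))
|}.

Lemma bilinear_pair (U V W X : vectType F) (f : U -> V -> W) (g : U -> V -> X) :
  bilinear_fun f -> bilinear_fun g -> bilinear_fun (fun u v => (f u v, g u v)).
Proof. by move=> [f1 f2] [g1 g2]; split=> u k y z; rewrite ?f1 ?g1 ?f2 ?g2. Qed.

Lemma bilinear_opp (U V W : vectType F) (f : U -> V -> W) :
  bilinear_fun f -> bilinear_fun (fun u v => - f u v).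
Proof. by move=> [f1 f2]; split=> u k y z; rewrite ?f1 ?f2 opprD -scalerN. Qed.

Lemma bilinear_swap (U V W : vectType F) (f : U -> V -> W) :
  bilinear_fun f -> bilinear_fun (fun v u => f u v).
Proof. by case. Qed.

Lemma transp_bilinear (f : A -> 'End(A)) :
  linear f -> bilinear_fun (fun x (a : dual A) => transp (f x) a).
Proof.
move=> lf; split=> [x | a] k y z; first by rewrite linearP.
by rewrite lf transp_linear add_lfunE scale_lfunE.
Qed.

Lemma transp_dual_bilinear (f : dual A -> 'End(dual A)) :
  linear f -> bilinear_fun (fun (a : dual A) x => transp_dual (f a) x).
Proof.
move=> lf; split=> [x | a] k y z; first by rewrite linearP.
by rewrite lf transp_dual_linear add_lfunE scale_lfunE.
Qed.

Lemma mixed_opE op ops m ms :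
  bilinear_fun m -> bilinear_fun ms ->
  forall u v, mixed_op op ops m ms u v =
    (op u.1 v.1, ops u.2 v.2) + m u.1 v.2 + ms u.2 v.1.
Proof.
move=> [m1 m2] [n1 n2]; have [p1 p2] := bilinear_lfun op.
have [s1 s2] := bilinear_lfun ops.
have addP (V : vectType F) (k : F) (x1 x2 x3 y1 y2 y3 : V) :
    k *: (x1 + x2 + x3) + (y1 + y2 + y3) =
    (k *: x1 + y1) + (k *: x2 + y2) + (k *: x3 + y3).
  by rewrite !scalerDr addrACA; congr (_ + _); rewrite addrACA.
apply: bilinE; split=> [[x a] | [y b]] k [x1 a1] [x2 a2]; rewrite addP /=.
  by congr (_ + _ + _); [rewrite p1 s1 | rewrite m1 | rewrite n1].
by congr (_ + _ + _); [rewrite p2 s2 | rewrite m2 | rewrite n2].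
Qed.

Section QDoubleTheory.
Variables (q : quadri_ops A) (qs : quadri_ops (dual A)).
Variables (x y : A) (a b : dual A).

Let bmixed (f : A -> 'End(A)) (g : dual A -> 'End(dual A)) :
  linear f -> linear g ->
  bilinear_fun (fun x a => (transp_dual (g a) x, transp (f x) a)).
Proof.
by move=> lf lg; apply: bilinear_pair;
   [apply: bilinear_swap; apply: transp_dual_bilinear | apply: transp_bilinear].
Qed.

Let bmixedN (f : A -> 'End(A)) (g : dual A -> 'End(dual A)) :
  linear f -> linear g ->
  bilinear_fun (fun x a => (- transp_dual (g a) x, - transp (f x) a)).
Proof. by move=> lf lg; exact: (bilinear_opp (bmixed lf lg)). Qed.

Lemma Q_double_nw : nw (Q_double q qs) (x, a) (y, b) =
  (nw q x y, nw qs a b) +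
  (transp_dual (L (qstar qs) b) x, transp (R (se q) x) b) +
  (transp_dual (R (se qs) a) y, transp (L (qstar q) y) a).
Proof.
by apply: mixed_opE; [|apply: bilinear_swap]; apply: bmixed;
   do ?[exact: L_linear | exact: R_linear].
Qed.

Lemma Q_double_ne : ne (Q_double q qs) (x, a) (y, b) =
  (ne q x y, ne qs a b) +
  (- transp_dual (L (qprec qs) b) x, - transp (R (qvee q) x) b) +
  (- transp_dual (R (qvee qs) a) y, - transp (L (qprec q) y) a).
Proof.
by apply: mixed_opE; [|apply: bilinear_swap]; apply: bmixedN;
   do ?[exact: L_linear | exact: R_linear].
Qed.

Lemma Q_double_sw : sw (Q_double q qs) (x, a) (y, b) =
  (sw q x y, sw qs a b) +
  (- transp_dual (L (qwedge qs) b) x, - transp (R (qsucc q) x) b) +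
  (- transp_dual (R (qsucc qs) a) y, - transp (L (qwedge q) y) a).
Proof.
by apply: mixed_opE; [|apply: bilinear_swap]; apply: bmixedN;
   do ?[exact: L_linear | exact: R_linear].
Qed.

Lemma Q_double_se : se (Q_double q qs) (x, a) (y, b) =
  (se q x y, se qs a b) +
  (transp_dual (L (nw qs) b) x, transp (R (qstar q) x) b) +
  (transp_dual (R (qstar qs) a) y, transp (L (nw q) y) a).
Proof.
by apply: mixed_opE; [|apply: bilinear_swap]; apply: bmixed;
   do ?[exact: L_linear | exact: R_linear].
Qed.

End QDoubleTheory.

End Bialgebra.

Definition nijenhuis (F : fieldType) (V : vectType F) (Om : {pred bilop V})
    (N : 'End(V)) : Prop :=
  forall op : bilop V, op \in Om ->
  forall u v, op (N u) (N v) = N (op (N u) v + op u (N v) - N (op u v)).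

Definition quadri_set (F : fieldType) (V : vectType F) (q : quadri_ops V) :
    {pred bilop V} :=
  [in [:: nw q; ne q; sw q; se q]].

Definition N_op (F : fieldType) (A : vectType F) (r : tens A A) (l1 l2 l3 l4 : F) :
    'End((A * dual A)%type) :=
  linfun (fun p : A * dual A =>
    (l1 *: tmor r p.2 + l2 *: p.1, l3 *: (tmor r)^-1%VF p.1 + l4 *: p.2)).

Lemma N_opE (F : fieldType) (A : vectType F) (r : tens A A) (l1 l2 l3 l4 : F) x a :
  N_op r l1 l2 l3 l4 (x, a) =
    (l1 *: tmor r a + l2 *: x, l3 *: (tmor r)^-1%VF x + l4 *: a).
Proof.
have combP (U V : vectType F) (f g : U -> V) m n :
    linear f -> linear g -> linear (fun p => m *: f p + n *: g p).
  move=> lf lg k u v; rewrite lf lg 3!scalerDr !scalerA addrACA.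
  by rewrite [m * k]mulrC [n * k]mulrC.
rewrite linfunE // => k u v; congr pair.
  by apply: (combP _ _ (fun p : A * dual A => tmor r p.2) (fun p => p.1)) => // m y z;
     rewrite linearP.
by apply: (combP _ _ (fun p : A * dual A => (tmor r)^-1%VF p.1) (fun p => p.2)) => // m y z;
   rewrite linearP.
Qed.

(* Main.v *)
(* Write T for T_r and, for each of the four operations o, let f_o(w) and     *)
(* g_o(w) be the endomorphisms of A^* giving the A^*-components of the mixed  *)
(* products w o_. b and a o_. w.  Skew-symmetry turns the induced operations  *)
(* into a o_* b = f_o(Ta) b + g_o(Tb) a, and the Q-equations make T a         *)
(* homomorphism from (A^*, o_* ) to (A, o).  When T is invertible, each product *)
(* of the double therefore has the form                                       *)
(*   u o_. v = f_o(s u) . v + g_o(s v) . u,  with s (x, a) = x + T a,         *)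
(* where an endomorphism h of A^* acts on A (+) A^* as (T h T^-1, h).  Such   *)
(* an action commutes with N, and this alone gives the Nijenhuis identity.    *)
Require Import Defs.
From HB Require Import structures.
From mathcomp Require Import all_boot all_order all_algebra.
From mathcomp Require Import ring.

Set Implicit Arguments.
Unset Strict Implicit.
Unset Printing Implicit Defensive.

Import GRing.Theory.
Local Open Scope ring_scope.
Local Open Scope lfun_scope.

(** Invertibility of [T] identifies the double with two copies of A^*, that is A^* (x) F^2. Under
    this identification [N] becomes the identity tensored with the 2 x 2 matrix of the lambdas,
    while left and right multiplications in the double are built from operators h (x) 1
    ([double_diag_act]). The two kinds commute whatever the lambdas are ([diag_actN]), and an
    operator commuting with both halves of a product is Nijenhuis ([nijenhuis_bimodule]). It remains
    to see that the double has this shape. Evaluated on a (x) b (x) c, the two Q-equations become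
    scalar identities for [sw] and [ne]; eliminating between them, after a cyclic rotation where
    necessary, gives those for [nw] and [se]. By [tmor_skew] the four identities say that [T] is a
    homomorphism for each operation ([tmor_hom_nw] and its analogues), and then [transp_dual_L] and
    [transp_dual_R] carry the coadjoint actions on A over to A^*. *)

(** * Contraction of tensors with functionals *)

Section Pairings.
Variable F : fieldType.
Implicit Types U V W X : vectType F.

Lemma pairing_linear U V (u : dual U) (v : dual V) :
  linear (fun t : tens U V => pairing t u v : GRing.regular F).
Proof. by move=> k s t; rewrite pairingP. Qed.

Lemma eq_tlift U V W (f g : U -> V -> W) (t : tens U V) :
  (forall x y, f x y = g x y) -> tlift f t = tlift g t.
Proof. by move=> e; apply: eq_bigr => i _; apply: eq_bigr => j _; rewrite e. Qed.

Lemma lfun_tlift U V W X (h : W -> X) (f : U -> V -> W) (t : tens U V) :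
  linear h -> h (tlift f t) = tlift (fun x y => h (f x y)) t.
Proof.
move=> lh; rewrite -(linfunE lh) linear_sum; apply: eq_bigr => i _.
rewrite linear_sum; apply: eq_bigr => j _.
by rewrite linearZ; congr (_ *: _); exact: linfunE.
Qed.

(** The contraction tool: a sum over one copy of a tensor collapses as soon as its summand factors
    as a product of two functionals. *)
Lemma tlift_pairing U V (u : dual U) (v : dual V) (t : tens U V)
    (f : U -> V -> GRing.regular F) :
  (forall x y, f x y = u x * v y) -> tlift f t = pairing t u v.
Proof.
move=> e; rewrite {2}(tens_sum t) (lfun_tlift _ _ (pairing_linear u v)).
by apply: eq_tlift => x y; rewrite pureE e.
Qed.

Lemma pairing_tmap U V (f : 'End(U)) (g : 'End(V)) (t : tens U V) u v :
  pairing (tmap f g t) u v = pairing t (transp f u) (transp g v).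
Proof.
rewrite (lfun_tlift _ _ (pairing_linear u v)); apply: tlift_pairing => x y.
by rewrite pureE !transpE.
Qed.

Lemma pairing_tswap U V (t : tens U V) u v : pairing (tswap t) u v = pairing t v u.
Proof.
rewrite (lfun_tlift _ _ (pairing_linear u v)); apply: tlift_pairing => x y.
by rewrite pureE mulrC.
Qed.

Lemma pairingD U V (s t : tens U V) u v :
  pairing (s + t) u v = pairing s u v + pairing t u v.
Proof. by rewrite /pairing !add_lfunE. Qed.

Lemma pairingN U V (t : tens U V) u v : pairing (- t) u v = - pairing t u v.
Proof. by rewrite /pairing !opp_lfunE. Qed.

Lemma pairing0 U V u v : pairing (0 : tens U V) u v = 0.
Proof. by rewrite /pairing !zero_lfunE. Qed.

(** Since [tens3] is bracketed to the left, [a] and [b] are first packed into one functional on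
    [tens V V]. *)
Definition pairing3 V (t : tens3 V) (a b c : dual V) : F :=
  pairing t (linfun (fun s : tens V V => pairing s a b : GRing.regular F)) c.

Lemma pairing3_pure V (x y z : V) a b c :
  pairing3 (pure3 x y z) a b c = a x * b y * c z.
Proof. by rewrite /pairing3 pureE linfunE ?pureE //; exact: pairing_linear. Qed.

Lemma pairing3_linear V (a b c : dual V) :
  linear (fun t : tens3 V => pairing3 t a b c : GRing.regular F).
Proof. exact: pairing_linear. Qed.

Lemma pairing3_tlift2 V (f : V -> V -> V -> V -> tens3 V) (r : tens V V) a b c :
  pairing3 (tlift (fun x y => tlift (f x y) r) r) a b c =
  tlift (fun x y =>
    tlift (fun x' y' => pairing3 (f x y x' y') a b c : GRing.regular F) r) r.
Proof.
rewrite (lfun_tlift _ _ (pairing3_linear a b c)).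
refine (eq_tlift (W := GRing.regular F) _ _) => x y.
by rewrite (lfun_tlift _ _ (pairing3_linear a b c)).
Qed.

End Pairings.

Definition op_morphism (F : fieldType) (U W : vectType F) (T : 'Hom(U, W))
    (ops : bilop U) (op : bilop W) : Prop :=
  forall a b, T (ops a b) = op (T a) (T b).

Lemma op_morphismD (F : fieldType) (U W : vectType F) (T : 'Hom(U, W))
    (ops ops' : bilop U) (op op' : bilop W) :
  op_morphism T ops op -> op_morphism T ops' op' ->
  op_morphism T (ops + ops') (op + op').
Proof. by move=> h h' a b; rewrite !add_lfunE linearD /= h h'. Qed.

(** * A commutation criterion for Nijenhuis operators *)

Section Bimodules.
Variables (F : fieldType) (V : vectType F).

(** Expanding the right-hand side, N^2 (u o v) = N (l u (N v) + r v (N u)) cancels exactly the two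
    terms where N hits the vector acted on and not the one acting. What remains is N (l (N u) v) + N
    (r (N v) u), the left-hand side. *)
Lemma nijenhuis_bimodule (op : bilop V) (N : 'End(V)) (l r : V -> V -> V) :
    (forall u v, op u v = l u v + r v u) ->
    (forall w v, N (l w v) = l w (N v)) ->
    (forall w v, N (r w v) = r w (N v)) ->
  forall u v, op (N u) (N v) = N (op (N u) v + op u (N v) - N (op u v)).
Proof.
move=> opE lN rN u v; rewrite !opE !(linearD, linearN) /= !(lN, rN) -opprD.
apply/esym/eqP; rewrite subr_eq [l u _ + r _ _]addrC addrACA.
by rewrite [r v _ + _]addrC.
Qed.

End Bimodules.

(** * Products on A (+) D that come from a diagonal action *)

Section Double.
Variables (F : fieldType) (A D : vectType F).
Variables (T : 'Hom(D, A)) (S : 'Hom(A, D)).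
Hypotheses (TK : cancel T S) (SK : cancel S T).
Variables (l1 l2 l3 l4 : F) (N : 'End((A * D)%type)).
Hypothesis NE : forall x a, N (x, a) = (l1 *: T a + l2 *: x, l3 *: S x + l4 *: a).
Variables (op : bilop A) (ops : bilop D) (opd : bilop (A * D)%type).
Variables f g : A -> 'End(D).
Hypothesis fD : forall w w' a, f (w + w') a = f w a + f w' a.
Hypothesis gD : forall w w' a, g (w + w') a = g w a + g w' a.
Hypothesis T_hom : op_morphism T ops op.
Hypothesis opsE : forall a b, ops a b = f (T a) b + g (T b) a.
Hypothesis opd1 : forall x y a b,
  (opd (x, a) (y, b)).1 = op x y + T (g (T b) (S x)) + T (f (T a) (S y)).
Hypothesis opd2 : forall x y a b,
  (opd (x, a) (y, b)).2 = ops a b + f x b + g y a.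

Definition diag_act (h : 'End(D)) (u : A * D) : A * D := (T (h (S u.1)), h u.2).

(** Both [T] and [S] intertwine T h S on A with h on D, and each block of [N] is a scalar multiple
    of [T], [S] or an identity. *)
Lemma diag_actN h u : N (diag_act h u) = diag_act h (N u).
Proof.
by case: u => x a; rewrite !NE /diag_act /= TK !(linearD, linearZ) /= !TK.
Qed.

Lemma double_diag_act u v :
  opd u v = diag_act (f (u.1 + T u.2)) v + diag_act (g (v.1 + T v.2)) u.
Proof.
case: u v => [x a] [y b]; rewrite [LHS]surjective_pairing opd1 opd2.
(* Pulling the product of A back to D puts it in the form f . y + g . x too, so the A-component
   matches the D-component. *)
have opE : op x y = T (ops (S x) (S y)) by rewrite T_hom !SK.
congr pair; rewrite /= ?opE opsE ?SK fD gD.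
  by rewrite !linearD /= -addrA [X in _ + X]addrC addrACA.
rewrite -addrA addrACA [X in X + _]addrC; congr (_ + _).
exact: addrC.
Qed.

Lemma nijenhuis_double u v :
  opd (N u) (N v) = N (opd (N u) v + opd u (N v) - N (opd u v)).
Proof.
exact: (nijenhuis_bimodule double_diag_act
  (fun _ => diag_actN _) (fun _ => diag_actN _)).
Qed.

End Double.

(** * The Q-equations as scalar identities *)

Section SkewSolutions.
Variables (F : fieldType) (A : vectType F) (q : quadri_ops A) (r : tens A A).
Hypothesis skew_r : tens_skew_symmetric r.
Implicit Types (x y : A) (a b c : dual A) (op : bilop A).
Let T := tmor r.

Lemma tmor_skew a b : a (T b) = - b (T a).
Proof. by rewrite !tmorE {1}skew_r pairingN pairing_tswap. Qed.

(** The two copies of [r] are contracted one at a time, the inner one with the legs of the outer one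
    frozen; each contraction inserts a [T]. In the two analogues below, a contraction that would put
    [T] on the wrong functional is turned by [tmor_skew], whence their use of skew-symmetry. *)
Lemma pairing_r12_r13 op a b c : pairing3 (r12_r13 op r) a b c = a (op (T b) (T c)).
Proof.
(* The right-hand side is rewritten as [r] paired with [b] and one transposed functional, so that it
   matches the outer copy. *)
rewrite pairing3_tlift2 -RE -transpE tmorE; apply: tlift_pairing => x y.
rewrite transpE RE.
transitivity (pairing r (b y *: transp (L op x) a) c); last first.
  by rewrite -tmorE scale_lfunE transpE; apply: mulrC.
apply: tlift_pairing => x' y'.
by rewrite pairing3_pure scale_lfunE transpE /= [b y *: _]mulrC.
Qed.

Lemma pairing_r13_r23 op a b c : pairing3 (r13_r23 op r) a b c = c (op (T a) (T b)).
Proof.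
rewrite pairing3_tlift2 -RE -transpE [RHS]tmor_skew tmorE -pairingN.
transitivity (pairing r (- a) (transp (R op (T b)) c)); last first.
  by rewrite pairingN /pairing linearN opp_lfunE.
apply: tlift_pairing => x y.
transitivity (pairing r (a x *: b) (transp (L op y) c)).
  apply: tlift_pairing => x' y'.
  by rewrite pairing3_pure scale_lfunE transpE.
rewrite -tmorE scale_lfunE tmor_skew opp_lfunE !transpE RE mulNr.
exact: mulrN.
Qed.

Lemma pairing_r23_r12 op a b c : pairing3 (r23_r12 op r) a b c = - b (op (T c) (T a)).
Proof.
rewrite pairing3_tlift2 -RE -transpE tmorE.
transitivity (pairing r (- transp (R op (T a)) b) c); last first.
  by rewrite /pairing linearN opp_lfunE.
apply: tlift_pairing => x y.
transitivity (pairing r a (c y *: transp (L op x) b)).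
  apply: tlift_pairing => x' y'.
  rewrite pairing3_pure scale_lfunE transpE -mulrA; congr (_ * _).
  exact: mulrC.
rewrite -tmorE tmor_skew scale_lfunE opp_lfunE !transpE RE mulNr.
by congr (- _); apply: mulrC.
Qed.

Hypothesis Q_r : Q_equations q r.

Lemma Q_equation_sw a b c :
  a (sw q (T b) (T c)) = b (qwedge q (T c) (T a)) + c (qsucc q (T a) (T b)).
Proof.
have := congr1 (fun t => pairing3 t a b c) (proj1 Q_r).
rewrite /pairing3 !(pairingD, pairingN) pairing0 -!/(pairing3 _ _ _ _).
rewrite pairing_r12_r13 pairing_r13_r23 pairing_r23_r12 -opprD addrC => /eqP.
by rewrite subr_eq0 => /eqP.
Qed.

Lemma Q_equation_ne a b c :
  c (ne q (T a) (T b)) = b (qvee q (T c) (T a)) + a (qprec q (T b) (T c)).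
Proof.
have := congr1 (fun t => pairing3 t a b c) (proj2 Q_r).
rewrite /pairing3 !(pairingD, pairingN) pairing0 -!/(pairing3 _ _ _ _).
rewrite pairing_r12_r13 pairing_r13_r23 pairing_r23_r12 -opprD addrC => /eqP.
by rewrite subr_eq0 => /eqP.
Qed.

(** Here [s] and [e] stand for the [sw] and [ne] terms shared by the two Q-equations; both drop out
    together. *)
Let eliminate (n p s e x : F) : s = n + e + p -> e = s + x -> n = - (x + p).
Proof.
move=> es ee; apply/eqP; rewrite -addr_eq0; apply/eqP/(addrI s).
by rewrite addr0 [RHS]es ee; ring.
Qed.

(** The sum is typed in [F], not in its regular module, for the sake of [ring]. *)
Lemma addf_lfunE a x y : a (x + y) = (a x : F) + (a y : F) :> F.
Proof. exact: (linearD a x y). Qed.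

Lemma Q_equation_nw a b c :
  c (nw q (T a) (T b)) = - b (se q (T c) (T a)) - a (qstar q (T b) (T c)).
Proof.
have e1 := Q_equation_sw b c a; have e2 := Q_equation_ne a b c.
rewrite /qwedge /qsucc /qvee /qprec /qstar !(add_lfunE, addf_lfunE) in e1 e2 *.
rewrite (@eliminate (c (nw q (T a) (T b)))
  (a (ne q (T b) (T c)) + a (se q (T b) (T c)))
  (b (sw q (T c) (T a))) (c (ne q (T a) (T b)))
  (b (se q (T c) (T a)) + a (nw q (T b) (T c)) + a (sw q (T b) (T c)))).
- by ring.
- by rewrite e1; ring.
by rewrite e2; ring.
Qed.

Lemma Q_equation_se a b c :
  c (se q (T a) (T b)) = - b (qstar q (T c) (T a)) - a (nw q (T b) (T c)).
Proof.
have e1 := Q_equation_sw a b c; have e2 := Q_equation_ne a b c.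
rewrite /qwedge /qsucc /qvee /qprec /qstar !(add_lfunE, addf_lfunE) in e1 e2 *.
rewrite (@eliminate (c (se q (T a) (T b)))
  (b (nw q (T c) (T a)) + b (ne q (T c) (T a)))
  (a (sw q (T b) (T c))) (c (ne q (T a) (T b)))
  (b (sw q (T c) (T a)) + b (se q (T c) (T a)) + a (nw q (T b) (T c)))).
- by ring.
- by rewrite e1; ring.
by rewrite e2; ring.
Qed.

Lemma pairing_tmap_L op x a b :
  pairing (tmap \1 (L op x) r) a b = - b (op x (T a)).
Proof.
rewrite pairing_tmap -tmorE.
have -> : transp \1 a = a by apply/lfunP=> y; rewrite transpE id_lfunE.
by rewrite tmor_skew transpE.
Qed.

Lemma pairing_tmap_R op x a b :
  pairing (tmap (R op x) \1 r) a b = a (op (T b) x).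
Proof.
rewrite pairing_tmap -tmorE transpE RE.
have -> : transp \1 b = b by apply/lfunP=> y; rewrite transpE id_lfunE.
by [].
Qed.

(** * The induced dual operations and the homomorphism [T] *)

Let qs := induced_dual q r.

Lemma induced_nwE a b :
  nw qs a b = transp (R (se q) (T a)) b + transp (L (qstar q) (T b)) a.
Proof.
have [lD _ _ _] := comul_linear q r.
apply/lfunP=> x; rewrite dual_opE // pairingD pairingN pairing_tmap_L.
by rewrite pairing_tmap_R opprK [RHS]add_lfunE !transpE RE.
Qed.

Lemma induced_neE a b :
  ne qs a b = (- transp (R (qvee q) (T a))) b + (- transp (L (qprec q) (T b))) a.
Proof.
have [_ lD _ _] := comul_linear q r.
apply/lfunP=> x; rewrite dual_opE // pairingD pairingN pairing_tmap_L.
by rewrite pairing_tmap_R [RHS]add_lfunE !opp_lfunE !transpE RE.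
Qed.

Lemma induced_swE a b :
  sw qs a b = (- transp (R (qsucc q) (T a))) b + (- transp (L (qwedge q) (T b))) a.
Proof.
have [_ _ lD _] := comul_linear q r.
apply/lfunP=> x; rewrite dual_opE // pairingD pairingN pairing_tmap_L.
by rewrite pairing_tmap_R [RHS]add_lfunE !opp_lfunE !transpE RE.
Qed.

Lemma induced_seE a b :
  se qs a b = transp (R (qstar q) (T a)) b + transp (L (nw q) (T b)) a.
Proof.
have [_ _ _ lD] := comul_linear q r.
apply/lfunP=> x; rewrite dual_opE // pairingD pairingN pairing_tmap_L.
by rewrite pairing_tmap_R opprK [RHS]add_lfunE !transpE RE.
Qed.

(** Paired with [c], skew-symmetry moves [T] off the dual product, and the formula for that product
    reproduces the right-hand side of [Q_equation_nw]. *)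
Lemma tmor_hom_nw : op_morphism T (nw qs) (nw q).
Proof.
move=> a b; apply: dual_ext => c; rewrite tmor_skew induced_nwE Q_equation_nw.
by rewrite add_lfunE !transpE RE opprD.
Qed.

Lemma tmor_hom_ne : op_morphism T (ne qs) (ne q).
Proof.
move=> a b; apply: dual_ext => c; rewrite tmor_skew induced_neE Q_equation_ne.
by rewrite [X in - X]add_lfunE !opp_lfunE !transpE RE opprD !opprK.
Qed.

Lemma tmor_hom_sw : op_morphism T (sw qs) (sw q).
Proof.
move=> a b; apply: dual_ext => c; rewrite tmor_skew induced_swE Q_equation_sw.
by rewrite [X in - X]add_lfunE !opp_lfunE !transpE RE opprD !opprK addrC.
Qed.

Lemma tmor_hom_se : op_morphism T (se qs) (se q).
Proof.
move=> a b; apply: dual_ext => c; rewrite tmor_skew induced_seE Q_equation_se.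
by rewrite add_lfunE !transpE RE opprD.
Qed.

(** The mixed products of the double also transpose multiplications by the sums of the arrows, so
    these must be preserved by [T] as well. *)
Lemma tmor_hom_succ : op_morphism T (qsucc qs) (qsucc q).
Proof. exact: op_morphismD tmor_hom_ne tmor_hom_se. Qed.

Lemma tmor_hom_prec : op_morphism T (qprec qs) (qprec q).
Proof. exact: op_morphismD tmor_hom_nw tmor_hom_sw. Qed.

Lemma tmor_hom_vee : op_morphism T (qvee qs) (qvee q).
Proof. exact: op_morphismD tmor_hom_sw tmor_hom_se. Qed.

Lemma tmor_hom_wedge : op_morphism T (qwedge qs) (qwedge q).
Proof. exact: op_morphismD tmor_hom_nw tmor_hom_ne. Qed.

Lemma tmor_hom_star : op_morphism T (qstar qs) (qstar q).
Proof. exact: op_morphismD (op_morphismD tmor_hom_wedge tmor_hom_sw) tmor_hom_se. Qed.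

(** * Nondegenerate [r]: the four operations of the double *)

Hypothesis nondeg_r : tens_nondegenerate r.
Let S := (tmor r)^-1%VF.

(** Writing x = T (S x), skew-symmetry moves [T] onto the dual product, where the homomorphism
    property applies; a second use of skew-symmetry moves it back. *)
Lemma transp_dual_L ops op a x : op_morphism T ops op ->
  transp_dual (L ops a) x = T (transp (L op (T a)) (S x)).
Proof.
have [_ SK] := tmorK nondeg_r; rewrite -{1}(SK x) => h; apply: dual_ext => b.
by rewrite transp_dualE [LHS]tmor_skew h [RHS]tmor_skew transpE.
Qed.

Lemma transp_dual_R ops op a x : op_morphism T ops op ->
  transp_dual (R ops a) x = T (transp (R op (T a)) (S x)).
Proof.
have [_ SK] := tmorK nondeg_r; rewrite -{1}(SK x) => h; apply: dual_ext => b.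
by rewrite transp_dualE RE [LHS]tmor_skew h [RHS]tmor_skew transpE RE.
Qed.

Lemma transp_RD op x y a :
  transp (R op (x + y)) a = transp (R op x) a + transp (R op y) a.
Proof. by apply/lfunP=> z; rewrite [RHS]add_lfunE !transpE !RE !linearD. Qed.

Lemma transp_LD op x y a :
  transp (L op (x + y)) a = transp (L op x) a + transp (L op y) a.
Proof.
by apply/lfunP=> z; rewrite [RHS]add_lfunE !transpE /L linearD add_lfunE linearD.
Qed.

Lemma N_transp_RD op x y a :
  (- transp (R op (x + y))) a = (- transp (R op x)) a + (- transp (R op y)) a.
Proof. by rewrite !opp_lfunE transp_RD opprD. Qed.

Lemma N_transp_LD op x y a :
  (- transp (L op (x + y))) a = (- transp (L op x)) a + (- transp (L op y)) a.
Proof. by rewrite !opp_lfunE transp_LD opprD. Qed.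

Variables l1 l2 l3 l4 : F.
Let N := N_op r l1 l2 l3 l4.
Let Dq := Q_double q qs.

(** In each of the four cases f and g are the signed transposes appearing in the A^*-components of
    the mixed products. *)
Lemma nijenhuis_Q_double_nw u v : let op := nw Dq in
  op (N u) (N v) = N (op (N u) v + op u (N v) - N (op u v)).
Proof.
have [TK SK] := tmorK nondeg_r.
apply: (@nijenhuis_double F A (dual A) T S TK SK l1 l2 l3 l4 N (N_opE r l1 l2 l3 l4)
  (nw q) (nw qs) (nw Dq) (fun w => transp (R (se q) w))
  (fun w => transp (L (qstar q) w)) (transp_RD _) (transp_LD _)
  tmor_hom_nw induced_nwE) => x y a b; rewrite Q_double_nw //=.
by rewrite (transp_dual_L _ _ tmor_hom_star) (transp_dual_R _ _ tmor_hom_se).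
Qed.

Lemma nijenhuis_Q_double_ne u v : let op := ne Dq in
  op (N u) (N v) = N (op (N u) v + op u (N v) - N (op u v)).
Proof.
have [TK SK] := tmorK nondeg_r.
apply: (@nijenhuis_double F A (dual A) T S TK SK l1 l2 l3 l4 N (N_opE r l1 l2 l3 l4)
  (ne q) (ne qs) (ne Dq) (fun w => - transp (R (qvee q) w))
  (fun w => - transp (L (qprec q) w)) (N_transp_RD _) (N_transp_LD _)
  tmor_hom_ne induced_neE) => x y a b; rewrite Q_double_ne /= ?opp_lfunE //.
by rewrite (transp_dual_L _ _ tmor_hom_prec) (transp_dual_R _ _ tmor_hom_vee) !linearN.
Qed.

Lemma nijenhuis_Q_double_sw u v : let op := sw Dq in
  op (N u) (N v) = N (op (N u) v + op u (N v) - N (op u v)).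
Proof.
have [TK SK] := tmorK nondeg_r.
apply: (@nijenhuis_double F A (dual A) T S TK SK l1 l2 l3 l4 N (N_opE r l1 l2 l3 l4)
  (sw q) (sw qs) (sw Dq) (fun w => - transp (R (qsucc q) w))
  (fun w => - transp (L (qwedge q) w)) (N_transp_RD _) (N_transp_LD _)
  tmor_hom_sw induced_swE) => x y a b; rewrite Q_double_sw /= ?opp_lfunE //.
by rewrite (transp_dual_L _ _ tmor_hom_wedge) (transp_dual_R _ _ tmor_hom_succ) !linearN.
Qed.

Lemma nijenhuis_Q_double_se u v : let op := se Dq in
  op (N u) (N v) = N (op (N u) v + op u (N v) - N (op u v)).
Proof.
have [TK SK] := tmorK nondeg_r.
apply: (@nijenhuis_double F A (dual A) T S TK SK l1 l2 l3 l4 N (N_opE r l1 l2 l3 l4)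
  (se q) (se qs) (se Dq) (fun w => transp (R (qstar q) w))
  (fun w => transp (L (nw q) w)) (transp_RD _) (transp_LD _)
  tmor_hom_se induced_seE) => x y a b; rewrite Q_double_se //=.
by rewrite (transp_dual_L _ _ tmor_hom_nw) (transp_dual_R _ _ tmor_hom_star).
Qed.

End SkewSolutions.

Theorem proposition8p3 (F : fieldType) (A : vectType F) (q : quadri_ops A)
    (r : tens A A) :
  quadri_algebra q ->
  tens_skew_symmetric r ->
  Q_equations q r ->
  tens_nondegenerate r ->
  forall l1 l2 l3 l4 : F,
    nijenhuis (quadri_set (Q_double q (induced_dual q r))) (N_op r l1 l2 l3 l4).
Proof.
move=> _ skew_r Q_r nondeg_r l1 l2 l3 l4 op; rewrite !inE.
case/or4P=> /eqP->.
- exact: nijenhuis_Q_double_nw.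
- exact: nijenhuis_Q_double_ne.
- exact: nijenhuis_Q_double_sw.
- exact: nijenhuis_Q_double_se.
Qed.
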